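(* Let $\mathcal A=(Q,\{a,b\},\delta)$ be an automaton in which $a$ is of type $[1,2]\backslash 1$ (with $1,2$ distinct states) and $b$ is of type $[x,y]\backslash x$ (with $x,y$ distinct states, not necessarily different from $1,2$). Then $\mathcal A$ is proper and $3$-compressible if and only if one of the following conditions holds: (1) $b=[2,y]\backslash 2$ (i.e. $x=2$), $y\ne 1$, and either $\{1ba,1b^2a,1b^3a\}\not\subseteq\{2,y\}$ or $Orb_a(1ba)\not\subseteq\{2,y\}$; (2) $b=[x,1]\backslash x$ (i.e. $y=1$), $x\ne 2$, and either $\{xab,xa^2b,xa^3b\}\not\subseteq\{1,2\}$ or $Orb_b(xab)\not\subseteq\{1,2\}$; (3) $b=[x,y]\backslash x$ with $x\notin\{1,2\}$, $y\ne 1$, $1b\in\{1,2\}$, $xa\in\{x,y\}$, and either $Orb_b(1)\not\subseteq\{1,2\}$ or $Orb_a(x)\not\subseteq\{x,y\}$. Moreover, if $\mathcal A$ is proper and $3$-compressible, then at least one of the words $abab$, $ab^2ab$, $ab^3ab$, $aba^2b$, $aba^3b$, $baba$, $ba^2ba$, $ba^3ba$, $bab^2a$, $bab^3a$ $3$-compresses $\mathcal A$.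
   Context: A (semi)automaton is $\mathcal A=(Q,\Sigma,\delta)$ with $Q$ a finite set of states, $\Sigma=\{a,b\}$, and $\delta:Q\times\Sigma\to Q$ total. Words act on states from the right, letter by letter from left to right: $qw$ is the state reached from $q$ by reading $w$ (so $1ba=(1b)a$), and $Qw=\{qw:q\in Q\}$. A word $w$ $3$-compresses $\mathcal A$ if $|Q|-|Qw|\ge 3$; $\mathcal A$ is $3$-compressible if some word $3$-compresses it. A $3$-compressible automaton is proper if no word of length $3$ $3$-compresses it. A letter $c$ is of type $[p,q]\backslash p$ (written $c=[p,q]\backslash p$), for distinct states $p,q$, if $pc=qc$, no other two distinct states have the same image under $c$, and $Q\setminus Qc=\{p\}$. For a letter $c$, $Orb_c(q)=\{qc^n:n\ge 0\}$. *)

(* Defs.v *)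
From HB Require Import structures.
From mathcomp Require Import all_boot.

Set Implicit Arguments.
Unset Strict Implicit.
Unset Printing Implicit Defensive.

(* The alphabet {a, b}. *)
Inductive letter := La | Lb.

Definition letter_to_bool (c : letter) : bool := if c is La then true else false.
Definition bool_to_letter (t : bool) : letter := if t then La else Lb.

Lemma letter_to_boolK : cancel letter_to_bool bool_to_letter.
Proof. by case. Qed.

HB.instance Definition _ := Finite.copy letter (can_type letter_to_boolK).

Record semiautomaton (Sigma : finType) := Semiautomaton {
  state : finType;
  step : state -> Sigma -> state
}.

Section Semiautomata.

Variables (Sigma : finType) (A : semiautomaton Sigma).
Local Notation Q := (state A).

(* [run q w] is qw: letters are read from left to right. *)
Definition run (q : Q) (w : seq Sigma) : Q := foldl (@step _ A) q w.

Definition image_word (w : seq Sigma) : {set Q} := [set run q w | q in [set: Q]].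

Definition compresses (k : nat) (w : seq Sigma) : bool :=
  k <= #|Q| - #|image_word w|.

Definition compressible (k : nat) : Prop := exists w, compresses k w.

(* Meant for 3-compressible automata; 3-compressibility itself is not included. *)
Definition is_proper : Prop := forall w, size w = 3 -> ~~ compresses 3 w.

(* [has_type c p q] is c = [p,q]\p. *)
Definition has_type (c : Sigma) (p q : Q) : Prop :=
  [/\ p != q,
      step p c = step q c,
      forall r s : Q, r != s -> step r c = step s c -> [set r; s] = [set p; q]
    & [set: Q] :\: image_word [:: c] = [set p]].

(* [fconnect f q] is the set of all iterates f^n q, n >= 0, whether or not f is
   injective; see [OrbP]. *)
Definition Orb (c : Sigma) (q : Q) : {set Q} :=
  [set r | fconnect (fun s => step s c) q r].

Lemma OrbP (c : Sigma) (q r : Q) :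
  reflect (exists n, r = run q (nseq n c)) (r \in Orb c q).
Proof.
have runE n s : run s (nseq n c) = iter n (fun t => step t c) s.
  by elim: n s => // n IHn s; rewrite iterSr -IHn.
rewrite inE; apply: (iffP idP) => [/iter_findex <- | [n ->]].
  by eexists; rewrite runE.
by rewrite runE fconnect_iter.
Qed.

End Semiautomata.

Arguments image_word {Sigma} A w.
Arguments compresses {Sigma} A k w.
Arguments compressible {Sigma} A k.
Arguments is_proper {Sigma} A.
Arguments has_type {Sigma} A c p q.
Arguments Orb {Sigma} A c q.

(* The words abab, ab^2ab, ab^3ab, aba^2b, aba^3b and their images under
   exchanging the two letters. *)
Definition candidate_words : seq (seq letter) :=
  [:: [:: La; Lb; La; Lb];
      [:: La; Lb; Lb; La; Lb];
      [:: La; Lb; Lb; Lb; La; Lb];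
      [:: La; Lb; La; La; Lb];
      [:: La; Lb; La; La; La; Lb];
      [:: Lb; La; Lb; La];
      [:: Lb; La; La; Lb; La];
      [:: Lb; La; La; La; Lb; La];
      [:: Lb; La; Lb; Lb; La];
      [:: Lb; La; Lb; Lb; Lb; La]].

(* Main.v *)
Require Import Defs.
From mathcomp Require Import all_boot.

Set Implicit Arguments.
Unset Strict Implicit.
Unset Printing Implicit Defensive.

(** Follow the set of states missed by Qw as w grows; w 3-compresses the
    automaton when three states are missed.  A letter c = [p,q]\p fills neither
    p nor the image of a missed state whose c-class is entirely missed.  Hence
    reading c keeps the number of missed states unchanged when p or q is
    already missed, and raises it by one when both are present.  So until the
    third state is lost, at most two states are missed, and the last letter
    read fixes one of them: it is 1 after a and x after b.  The other one is an
    image of an earlier missed state, and what happens next depends only on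
    whether it lies in {1,2} (before a) or in {x,y} (before b).

    This leaves three situations, according to whether x is in {1,2} and whether
    1 is in {x,y}.

    - Both ([full_overlap_incompressible]): the state missed after one letter
      is always in the pair merged by the other letter, so a second state is
      never lost.

    - Exactly one.  If y = 1 and x is not 2, two states are missed only after
      reading a with x missed, and the missed states are then {1, xa^j} or
      {x, xa^j b^k} with j, k >= 1.  A third one is lost by reading a exactly
      when some xa^j b^k is outside {1,2}, and this takes at least four letters,
      so that the automaton is proper.  The infinitely many memberships reduce
      to the second condition because, as long as these hold, xa, xa^2, xa^3
      lie in a set of two states and the a-orbit of xa has period at most two
      ([trapped_one_overlap]).  Exchanging the letters turns this condition into
      the first one, so both come from the same lemmas.

    - Neither: the missed pairs are {x, 1b^k} and {1, xa^j} with j, k >= 1, and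
      a third state is lost as soon as some 1b^k is outside {1,2} or some xa^j
      is outside {x,y} ([missed_no_overlap]).  For k = 1 or j = 1 this makes aba
      or bab 3-compressing, so properness is 1b in {1,2} together with xa in
      {x,y}.

    The short words in the last claim come from [iter_in_pair]: an orbit that
    stays in a pair for its first three terms stays there for ever. *)

(** * Orbits in a pair *)

(** Among three consecutive terms of the orbit two coincide, so the orbit never
    visits a third state. *)
Lemma iter_in_pair (T : finType) (f : T -> T) (t u v : T) :
  t \in [set u; v] -> f t \in [set u; v] -> f (f t) \in [set u; v] ->
  forall n, iter n f t \in [set u; v].
Proof.
move=> t0 t1 t2.
have back : f (f t) \in [set t; f t].
  have [E | ne] := eqVneq (f t) t; first by rewrite !E set21.
  have <- : [set u; v] = [set t; f t]; last by [].
  apply/esym/eqP; rewrite eqEcard subUset !sub1set t0 t1 /=.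
  by rewrite !cards2 [t == _]eq_sym ne; case: (u != v).
suff sub n : iter n f t \in [set t; f t].
  by move=> n; have /set2P[-> | ->] := sub n.
elim: n => [|n IHn]; first by rewrite set21.
by rewrite iterS; have /set2P[-> | ->] := IHn; rewrite ?set22.
Qed.

(** * Missed states and the action of a letter on them *)
Section MissedStates.

Variables (Sigma : finType) (A : semiautomaton Sigma).
Local Notation Q := (state A).
Implicit Types (c d : Sigma) (p q r s u v x y z : Q) (w : seq Sigma).
Implicit Type M : {set Q}.

Definition missed w : {set Q} := ~: image_word A w.

Definition lost c M : {set Q} := ~: [set step s c | s in ~: M].

(** The missed states after a letter depend only on those before it, so words
    can be followed on complements of images alone, which stay small. *)
Lemma missedE w : missed w = foldl (fun M c => lost c M) set0 w.
Proof.
elim/last_ind: w => [|w c IHw].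
  rewrite /missed; apply/setP=> r; rewrite !inE; apply/negbTE.
  by rewrite negbK; apply/imsetP; exists r; rewrite ?inE.
rewrite -cats1 foldl_cat /= -IHw /missed /lost setCK; congr (~: _).
apply/setP=> r; apply/imsetP/imsetP => [[s _ ->] | [_ /imsetP[s _ ->] ->]].
  by exists (run s w); rewrite ?imset_f ?inE // /run foldl_cat.
by exists s; rewrite ?inE // /run foldl_cat.
Qed.

Lemma missed_rcons w c : missed (rcons w c) = lost c (missed w).
Proof. by rewrite !missedE -cats1 foldl_cat. Qed.

Lemma compressesE k w : compresses A k w = (k <= #|missed w|).
Proof. by rewrite /compresses /missed [#|~: _|]cardsCs setCK. Qed.

Lemma compresses_cat k w1 w2 :
  compresses A k w1 -> compresses A k (w1 ++ w2).
Proof.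
move=> /leq_trans; apply; apply: leq_sub2l.
have -> : image_word A (w1 ++ w2) = [set run r w2 | r in image_word A w1].
  rewrite /image_word -imset_comp; apply: eq_imset => r /=.
  by rewrite /run foldl_cat.
exact: leq_imset_card.
Qed.

Lemma run_nseq c q n : run q (nseq n c) = iter n (fun s => step s c) q.
Proof. by elim: n q => // n IHn q; rewrite iterSr -IHn. Qed.

Lemma Orb_subP c q (S : {set Q}) :
  reflect (forall n, iter n (fun s => step s c) q \in S) (Orb A c q \subset S).
Proof.
apply: (iffP subsetP) => [sub n | sub _ /OrbP[n ->]]; last by rewrite run_nseq.
by apply: sub; apply/OrbP; exists n; rewrite run_nseq.
Qed.

Lemma lostP c M r :
  reflect (forall s, step s c = r -> s \in M) (r \in lost c M).
Proof.
rewrite inE; apply: (iffP idP) => [rN s sr | rM].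
  by apply: contraR rN => sM; apply/imsetP; exists s; rewrite ?inE.
by apply/imsetP=> -[s sM rs]; move: sM; rewrite inE rM.
Qed.

Section OneLetter.

Variables (c : Sigma) (p q : Q).
Hypothesis cT : has_type A c p q.

Lemma type_neq : p != q. Proof. by case: cT. Qed.

Lemma type_eq : step p c = step q c. Proof. by case: cT. Qed.

Lemma type_coll r s :
  step r c = step s c -> [\/ r = s, r = p /\ s = q | r = q /\ s = p].
Proof.
case: cT => pq _ coll _ rs; have [-> | ne] := eqVneq r s; first exact: Or31.
have E := coll r s ne rs.
have /set2P[rE | rE] : r \in [set p; q] by rewrite -E set21.
  have /set2P[sE | sE] : s \in [set p; q] by rewrite -E set22.
    by rewrite rE sE eqxx in ne.
  exact: Or32.
have /set2P[sE | sE] : s \in [set p; q] by rewrite -E set22.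
  exact: Or33.
by rewrite rE sE eqxx in ne.
Qed.

(** Off either element of the merged pair, c is injective. *)
Lemma type_inj r s u :
  u \in [set p; q] -> r != u -> s != u -> step r c = step s c -> r = s.
Proof.
move=> uP ru su /type_coll[// | [rE sE] | [rE sE]]; subst r s;
  by case/set2P: uP ru su => ->; rewrite eqxx.
Qed.

Lemma type_missed r : (r == p) = (r \notin image_word A [:: c]).
Proof.
by case: cT => _ _ _ /setP/(_ r); rewrite in_setD in_setT andbT in_set1.
Qed.

Lemma type_step r : step r c != p.
Proof.
by rewrite type_missed negbK; apply/imsetP; exists r.
Qed.

Lemma type_surj r : r != p -> exists s, step s c = r.
Proof. by rewrite type_missed negbK => /imsetP[s _ ->]; exists s. Qed.

Lemma lost_p M : p \in lost c M.
Proof. by apply/lostP=> s sp; have := type_step s; rewrite sp eqxx. Qed.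

Lemma lost_free z M :
  z \in M -> z \notin [set p; q] -> step z c \in lost c M.
Proof.
move=> zM zP; apply/lostP=> s /type_coll[-> // | [_ zE] | [_ zE]];
  by rewrite zE !inE eqxx ?orbT in zP.
Qed.

Lemma lost_set0 : lost c set0 = [set p].
Proof.
apply/eqP; rewrite eqEsubset sub1set lost_p andbT.
apply/subsetP=> r /lostP rM; rewrite inE; apply: contraT => /type_surj[s sr].
by have := rM s sr; rewrite inE.
Qed.

Lemma type_twin u : u \in [set p; q] ->
  exists2 u', u' != u & step u' c = step u c.
Proof.
case/set2P=> ->; first by exists q; rewrite ?type_eq // eq_sym type_neq.
by exists p; rewrite ?type_eq // type_neq.
Qed.

(** The element of the merged pair that is still present keeps the common image
    reached, so nothing beyond p is lost. *)
Lemma lost_twin u : u \in [set p; q] -> lost c [set u] = [set p].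
Proof.
move=> uP; apply/eqP; rewrite eqEsubset sub1set lost_p andbT.
apply/subsetP=> r /lostP rM; rewrite inE; apply: contraT => /type_surj[s sr].
have sE := set1P (rM s sr); have [u' neq uE] := type_twin uP.
have u'E : u' = u by apply/set1P/rM; rewrite uE -sE.
by rewrite u'E eqxx in neq.
Qed.

(** If z is the other element of the merged pair, the common image disappears,
    and it is [step z c]; otherwise u has a present twin and only z counts.
    Taking both cases together is what makes the invariants below uniform. *)
Lemma lost_twin2 u z : u \in [set p; q] -> z != u ->
  lost c [set u; z] = [set p; step z c].
Proof.
move=> uP zu; apply/eqP; rewrite eqEsubset subUset !sub1set lost_p.
apply/andP; split.
  apply/subsetP=> r /lostP rM; rewrite !inE; have [// | /type_surj[s sr]] := eqVneq r p.
  have /set2P[sE | sE] := rM s sr; last by rewrite -sE sr eqxx.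
  have [u' neq uE] := type_twin uP.
  have u'r : step u' c = r by rewrite uE -sE.
  have /set2P[u'E | <-] := rM u' u'r; last by rewrite u'r eqxx orbT.
  by rewrite u'E eqxx in neq.
apply/lostP=> s sz; have [-> | su] := eqVneq s u; first exact: set21.
by rewrite (type_inj uP su zu sz) set22.
Qed.

Lemma lost_free1 z : z \notin [set p; q] ->
  lost c [set z] = [set p; step z c].
Proof.
move=> zP; apply/eqP; rewrite eqEsubset subUset !sub1set lost_p.
rewrite lost_free ?set11 //= andbT; apply/subsetP=> r /lostP rM; rewrite !inE.
have [// | /type_surj[s sr]] := eqVneq r p.
by rewrite -sr (set1P (rM s sr)) eqxx.
Qed.

(** With both merged states present, the new missed state p comes in addition
    to the images of the old ones: this is how a third state is lost. *)
Lemma lost_free2 u v : u \notin [set p; q] -> v \notin [set p; q] -> u != v ->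
  3 <= #|lost c [set u; v]|.
Proof.
move=> uP vP uv.
have sub : p |: [set step u c; step v c] \subset lost c [set u; v].
  by rewrite !subUset !sub1set lost_p !lost_free ?set21 ?set22.
apply: leq_trans (subset_leq_card sub).
rewrite cardsU1 cards2 !inE negb_or ![p == _]eq_sym !type_step.
rewrite (_ : _ != _) //; apply: contra uv => /eqP uv.
by apply/eqP; apply: (type_inj (set21 p q)) uv;
  [apply: contra uP | apply: contra vP] => /eqP ->; rewrite set21.
Qed.

End OneLetter.

(** * Each letter's missed state is merged by the other letter *)
Section TwoLetters.

Variables (c d : Sigma) (p q x y : Q).
Hypothesis letters : forall e : Sigma, e = c \/ e = d.
Hypotheses (cT : has_type A c p q) (dT : has_type A d x y).

Lemma full_overlap_incompressible w :
  x \in [set p; q] -> p \in [set x; y] -> ~~ compresses A 3 w.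
Proof.
move=> xP pX; rewrite compressesE -leqNgt.
suff [-> | -> | ->] : [\/ missed w = set0, missed w = [set p]
                        | missed w = [set x]]; rewrite ?cards0 ?cards1 //.
elim/last_ind: w => [|w e IHw]; first by rewrite missedE; apply: Or31.
rewrite missed_rcons; case: (letters e) => ->.
  apply: Or32; case: IHw => ->; rewrite ?(lost_set0 cT) ?(lost_twin cT) //.
  exact: set21.
apply: Or33; case: IHw => ->; rewrite ?(lost_set0 dT) ?(lost_twin dT) //.
exact: set21.
Qed.

(** * Neither missed state is merged by the other letter *)
Section NoOverlap.

Hypotheses (xP : x \notin [set p; q]) (pX : p \notin [set x; y]).

Lemma missed_no_overlap_cd : missed [:: c; d] = [set x; step p d].
Proof. by rewrite missedE /= (lost_set0 cT) (lost_free1 dT). Qed.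

Lemma missed_no_overlap_cdd : missed [:: c; d; d] = [set x; step (step p d) d].
Proof.
rewrite (missed_rcons [:: c; d]) missed_no_overlap_cd.
by rewrite (lost_twin2 dT) ?set21 ?(type_step dT).
Qed.

Lemma no_overlap_cdc : step p d \notin [set p; q] -> compresses A 3 [:: c; d; c].
Proof.
move=> pdP; rewrite compressesE (missed_rcons [:: c; d]) missed_no_overlap_cd.
by apply: (lost_free2 cT); rewrite // eq_sym (type_step dT).
Qed.

Lemma no_overlap_cddc :
  step (step p d) d \notin [set p; q] -> compresses A 3 [:: c; d; d; c].
Proof.
move=> pdP; rewrite compressesE (missed_rcons [:: c; d; d]).
rewrite missed_no_overlap_cdd.
by apply: (lost_free2 cT); rewrite // eq_sym (type_step dT).
Qed.

(** The first hypothesis puts the first two terms of the d-orbit of p in the pair, so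
    the third one leaves it and cddc is 3-compressing already; its extension
    cddcd is the one of the form ab^2ab or ba^2ba. *)
Lemma no_overlap_orbit : step p d \in [set p; q] ->
  ~~ (Orb A d p \subset [set p; q]) -> compresses A 3 [:: c; d; d; c; d].
Proof.
move=> pdP orbN; apply: (compresses_cat [:: d] (no_overlap_cddc _)).
apply: contra orbN => pddP; apply/Orb_subP.
exact: iter_in_pair (set21 p q) pdP pddP.
Qed.

End NoOverlap.

(** Invariant on the set missed by a word of length n.  The escape
    constructors allow any set once some orbit element has left the merged
    pair; recording how many letters this takes yields properness. *)
Inductive no_overlap_shape (n : nat) : {set Q} -> Prop :=
| NoOverlapNone : no_overlap_shape n set0
| NoOverlapC of 0 < n : no_overlap_shape n [set p]
| NoOverlapD of 0 < n : no_overlap_shape n [set x]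
| NoOverlapCD k of k.+1 < n :
    no_overlap_shape n [set x; iter k.+1 (fun s => step s d) p]
| NoOverlapDC j of j.+1 < n :
    no_overlap_shape n [set p; iter j.+1 (fun s => step s c) x]
| NoOverlapEscapeD M k of k.+1 < n
    & iter k (fun s => step s d) p \notin [set p; q] : no_overlap_shape n M
| NoOverlapEscapeC M j of j.+1 < n
    & iter j (fun s => step s c) x \notin [set x; y] : no_overlap_shape n M.

Lemma missed_no_overlap w : x \notin [set p; q] -> p \notin [set x; y] ->
  no_overlap_shape (size w) (missed w).
Proof.
move=> xP pX; elim/last_ind: w => [|w e IHw].
  by rewrite missedE; apply: NoOverlapNone.
rewrite missed_rcons size_rcons.
case: IHw => [|n0|n0|k kn|j jn|M k kn kP|M j jn jX].
- case: (letters e) => ->; first by rewrite (lost_set0 cT); apply: NoOverlapC.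
  by rewrite (lost_set0 dT); apply: NoOverlapD.
- case: (letters e) => ->.
    by rewrite (lost_twin cT) ?set21 //; apply: NoOverlapC.
  by rewrite (lost_free1 dT) //; apply: (NoOverlapCD (k := 0)).
- case: (letters e) => ->.
    by rewrite (lost_free1 cT) //; apply: (NoOverlapDC (j := 0)).
  by rewrite (lost_twin dT) ?set21 //; apply: NoOverlapD.
- case: (letters e) => ->; last first.
    rewrite (lost_twin2 dT) ?set21 ?(type_step dT) //.
    exact: (NoOverlapCD (k := k.+1)).
  have [kP | kP] := boolP (iter k.+1 (fun s => step s d) p \in [set p; q]).
    rewrite setUC (lost_twin2 cT) //; last by rewrite eq_sym (type_step dT).
    by apply: (NoOverlapDC (j := 0)); rewrite ltnS; apply: leq_ltn_trans kn.
  exact: (NoOverlapEscapeD _ _ kP).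
- case: (letters e) => ->.
    rewrite (lost_twin2 cT) ?set21 ?(type_step cT) //.
    exact: (NoOverlapDC (j := j.+1)).
  have [jX | jX] := boolP (iter j.+1 (fun s => step s c) x \in [set x; y]).
    rewrite setUC (lost_twin2 dT) //; last by rewrite eq_sym (type_step cT).
    by apply: (NoOverlapCD (k := 0)); rewrite ltnS; apply: leq_ltn_trans jn.
  exact: (NoOverlapEscapeC _ _ jX).
- by apply: (NoOverlapEscapeD _ _ kP); apply: ltnW.
- by apply: (NoOverlapEscapeC _ _ jX); apply: ltnW.
Qed.

(** The orbit elements with exponents 0 and 1 are in the pairs by assumption,
    so an escape has exponent at least 2 and costs at least four letters. *)
Lemma no_overlap_necessary w : x \notin [set p; q] -> p \notin [set x; y] ->
  step p d \in [set p; q] -> step x c \in [set x; y] -> compresses A 3 w ->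
  (~~ (Orb A d p \subset [set p; q]) \/ ~~ (Orb A c x \subset [set x; y]))
  /\ 3 < size w.
Proof.
move=> xP pX pdP xcX; rewrite compressesE => w3.
case: (missed_no_overlap w xP pX) w3 =>
  [|_|_|k _|j _|M [|[|k]] //= kn kP _|M [|[|j]] //= jn jX _];
  rewrite ?cards0 ?cards1 ?cards2 //; try by case: (_ != _).
- by rewrite set21 in kP.
- by rewrite pdP in kP.
- by split; [left; apply: contra kP => /Orb_subP/(_ k.+2) | apply: leq_trans kn].
- by rewrite set21 in jX.
- by rewrite xcX in jX.
- by split; [right; apply: contra jX => /Orb_subP/(_ j.+2) | apply: leq_trans jn].
Qed.

End TwoLetters.

(** * The state missed by one letter is merged by the other, but not conversely *)
Section OneOverlap.

Variables (c d : Sigma) (p q x : Q).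
Hypothesis letters : forall e : Sigma, e = c \/ e = d.
Hypotheses (cT : has_type A c p q) (dT : has_type A d x p) (xq : x != q).

Local Notation "'z_ j" := (iter j.+1 (fun s => step s c) x)
  (at level 8, j at level 2, format "''z_' j").

Let xp : x != p. Proof. exact: type_neq dT. Qed.

Let xP : x \notin [set p; q]. Proof. by rewrite !inE negb_or xp. Qed.

(** Invariant on the set missed by a word of length n; as above, the bounds on
    n serve to show that an escape needs at least four letters. *)
Inductive one_overlap_shape (n : nat) : {set Q} -> Prop :=
| OneOverlapNone : one_overlap_shape n set0
| OneOverlapC of 0 < n : one_overlap_shape n [set p]
| OneOverlapD of 0 < n : one_overlap_shape n [set x]
| OneOverlapDC j of 1 < n : one_overlap_shape n [set p; 'z_j]
| OneOverlapDCD j k of 2 < n :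
    one_overlap_shape n [set x; iter k.+1 (fun s => step s d) 'z_j]
| OneOverlapEscape M j k of 3 < n
    & iter k.+1 (fun s => step s d) 'z_j \notin [set p; q] :
    one_overlap_shape n M.

Lemma missed_one_overlap w : one_overlap_shape (size w) (missed w).
Proof.
elim/last_ind: w => [|w e IHw].
  by rewrite missedE; apply: OneOverlapNone.
rewrite missed_rcons size_rcons.
case: IHw => [|n0|n0|j n1|j k n2|M j k n3 zP].
- case: (letters e) => ->; first by rewrite (lost_set0 cT); apply: OneOverlapC.
  by rewrite (lost_set0 dT); apply: OneOverlapD.
- case: (letters e) => ->.
    by rewrite (lost_twin cT) ?set21 //; apply: OneOverlapC.
  by rewrite (lost_twin dT) ?set22 //; apply: OneOverlapD.
- case: (letters e) => ->.
    by rewrite (lost_free1 cT) //; apply: (OneOverlapDC 0).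
  by rewrite (lost_twin dT) ?set21 //; apply: OneOverlapD.
- case: (letters e) => ->.
    rewrite (lost_twin2 cT) ?set21 ?(type_step cT) //.
    by apply: (OneOverlapDC j.+1); apply: ltnW.
  rewrite (lost_twin2 dT) ?set22 ?(type_step cT) //.
  exact: (OneOverlapDCD j 0).
- case: (letters e) => ->; last first.
    rewrite (lost_twin2 dT) ?set21 ?(type_step dT) //.
    by apply: (OneOverlapDCD j k.+1); apply: ltnW.
  have [zP | zP] := boolP (iter k.+1 (fun s => step s d) 'z_j \in [set p; q]).
    rewrite setUC (lost_twin2 cT) //; last by rewrite eq_sym (type_step dT).
    by apply: (OneOverlapDC 0); rewrite ltnS; apply: leq_trans n2.
  exact: (OneOverlapEscape _ _ zP).
- by apply: (OneOverlapEscape _ _ zP); apply: ltnW.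
Qed.

(** On the states other than p both letters are injective.  The three
    predecessors z0, z1, z2 have their d-images in a pair, so two of them
    coincide and the c-orbit of z0 has period at most two.  With period one the
    orbit hypothesis is the whole claim.  With period two, the d-images of z0
    and z1 are p and q in some order, and it remains to see that d maps the
    pair to itself. *)
Lemma trapped_one_overlap :
    step 'z_0 d \in [set p; q] -> step 'z_1 d \in [set p; q] ->
    step 'z_2 d \in [set p; q] -> Orb A d (step 'z_0 d) \subset [set p; q] ->
  forall j k, iter k.+1 (fun s => step s d) 'z_j \in [set p; q].
Proof.
move=> P0 P1 P2 /Orb_subP orb.
have cI r s : r != p -> s != p -> step r c = step s c -> r = s.
  by move=> rp sp; apply: (type_inj cT (set21 p q) rp sp).
have dI r s : r != p -> s != p -> step r d = step s d -> r = s.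
  by move=> rp sp; apply: (type_inj dT (set22 x p) rp sp).
have zp j : 'z_j != p by exact: type_step cT _.
have stable : 'z_1 = 'z_0 ->
    forall j k, iter k.+1 (fun s => step s d) 'z_j \in [set p; q].
  move=> z10 j k; suff -> : 'z_j = 'z_0 by rewrite iterSr; apply: orb.
  by elim: j => // j IHj; rewrite iterS IHj.
have [/stable // | z10] := eqVneq 'z_1 'z_0.
have z21 : 'z_2 != 'z_1.
  by apply: contra z10 => /eqP E; apply/eqP; exact: (cI _ _ (zp 1) (zp 0) E).
have zd10 : step 'z_1 d != step 'z_0 d.
  by apply: contra z10 => /eqP E; apply/eqP; exact: (dI _ _ (zp 1) (zp 0) E).
have zd21 : step 'z_2 d != step 'z_1 d.
  by apply: contra z21 => /eqP E; apply/eqP; exact: (dI _ _ (zp 2) (zp 1) E).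
have z20 : 'z_2 = 'z_0.
  apply: dI (zp 2) (zp 0) _; move: P0 P1 P2 zd10 zd21.
  by do 3![case/set2P=> ->]; rewrite ?eqxx.
(* The d-orbit of the first of p, q it meets stays in the pair.  It could miss
   the other one only by being constant; each such case forces z0 or z1 to
   be x, because x is the twin of p under d and the c-predecessor of z0. *)
have xd : step x d = step p d := type_eq dT.
have [pd qd] : step p d \in [set p; q] /\ step q d \in [set p; q].
  have o1 : step (step 'z_0 d) d \in [set p; q] := orb 1.
  have o2 : step (step (step 'z_0 d) d) d \in [set p; q] := orb 2.
  case/set2P: P0 => E0; rewrite E0 in o1 o2.
    split=> //; case/set2P: o1 => pdE; last by rewrite pdE in o2.
    have z0x : 'z_0 = x by apply: dI (zp 0) xp _; rewrite E0 xd pdE.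
    by case/eqP: z10; rewrite iterS z0x -[RHS]z0x.
  split=> //; case/set2P: o1 => qdE; first by rewrite qdE in o2.
  have qp : q != p by rewrite eq_sym (type_neq cT).
  have z1x : 'z_1 = x by apply: cI (zp 1) xp _.
  case/set2P: P1 => E1; last by rewrite E0 E1 eqxx in zd10.
  by rewrite -xd -z1x E1 set21.
have Pz j : step 'z_j d \in [set p; q].
  suff : 'z_j \in [set 'z_0; 'z_1] by case/set2P=> ->.
  elim: j => [|j IHj]; first exact: set21.
  rewrite iterS; case/set2P: IHj => ->; first exact: set22.
  by rewrite -[step 'z_1 c]/('z_2) z20 set21.
move=> j; elim=> [|k IHk]; first exact: Pz.
by rewrite iterS; case/set2P: IHk => ->.
Qed.

(** The last clause of the second condition when c = a and d = b, and of the
    first one when c = b and d = a. *)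
Definition one_overlap_escapes : Prop :=
  ~~ ([set run x [:: c; d]; run x [:: c; c; d]; run x [:: c; c; c; d]]
        \subset [set p; q])
  \/ ~~ (Orb A d (run x [:: c; d]) \subset [set p; q]).

Lemma one_overlap_necessary w :
  compresses A 3 w -> one_overlap_escapes /\ 3 < size w.
Proof.
rewrite compressesE => w3.
case: (missed_one_overlap w) w3 => [|_|_|j _|j k _|M j k n3 zP _];
  rewrite ?cards0 ?cards1 ?cards2 //; try by case: (_ != _).
split=> //; rewrite /one_overlap_escapes; apply/orP; rewrite -negb_and.
apply: contra zP; rewrite !subUset !sub1set => /andP[/andP[/andP[P0 P1] P2] orb].
exact: trapped_one_overlap.
Qed.

(** If one of the three listed images leaves the pair, one of dcdc, dccdc, dcccdc
    works; if it is the orbit that leaves, it does so within three steps. *)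
Lemma one_overlap_sufficient : one_overlap_escapes ->
  exists2 w, w \in [:: [:: d; c; d; c]; [:: d; c; c; d; c];
                       [:: d; c; c; c; d; c]; [:: d; c; d; d; c];
                       [:: d; c; d; d; d; c]]
    & compresses A 3 w.
Proof.
have esc w z : missed w = [set x; step z d] -> step z d \notin [set p; q] ->
    compresses A 3 (rcons w c).
  move=> wE zP; rewrite compressesE missed_rcons wE.
  by apply: (lost_free2 cT); rewrite // eq_sym (type_step dT).
have dcE : missed [:: d; c] = [set p; 'z_0].
  by rewrite missedE /= (lost_set0 dT) (lost_free1 cT).
have dccE : missed [:: d; c; c] = [set p; 'z_1].
  rewrite (missed_rcons [:: d; c]) dcE.
  by rewrite (lost_twin2 cT) ?set21 ?(type_step cT).
have dcccE : missed [:: d; c; c; c] = [set p; 'z_2].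
  rewrite (missed_rcons [:: d; c; c]) dccE.
  by rewrite (lost_twin2 cT) ?set21 ?(type_step cT).
have thenD w j : missed w = [set p; 'z_j] ->
    missed (rcons w d) = [set x; step 'z_j d].
  move=> wE; rewrite missed_rcons wE.
  by rewrite (lost_twin2 dT) ?set22 ?(type_step cT).
have againD w z : missed w = [set x; step z d] ->
    missed (rcons w d) = [set x; step (step z d) d].
  move=> wE; rewrite missed_rcons wE.
  by rewrite (lost_twin2 dT) ?set21 ?(type_step dT).
have dcdE := thenD _ 0 dcE.
have [P0 | P0] := boolP (run x [:: c; d] \in [set p; q]); last first.
  by exists [:: d; c; d; c]; rewrite ?mem_head //; apply: esc dcdE P0.
case=> escapes.
  have [P1 | P1] := boolP (run x [:: c; c; d] \in [set p; q]); last first.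
    exists [:: d; c; c; d; c]; first by rewrite !inE eqxx ?orbT.
    exact: esc (thenD _ 1 dccE) P1.
  exists [:: d; c; c; c; d; c]; first by rewrite !inE eqxx ?orbT.
  apply: esc (thenD _ 2 dcccE) _; apply: contra escapes => P2.
  by rewrite !subUset !sub1set P0 P1.
have dcddE := againD _ _ dcdE.
have [P1 | P1] := boolP (run x [:: c; d; d] \in [set p; q]); last first.
  exists [:: d; c; d; d; c]; first by rewrite !inE eqxx ?orbT.
  exact: esc dcddE P1.
exists [:: d; c; d; d; d; c]; first by rewrite !inE eqxx ?orbT.
apply: esc (againD _ _ dcddE) _; apply: contra escapes => P2.
by apply/Orb_subP; apply: iter_in_pair P0 P1 P2.
Qed.

End OneOverlap.

Lemma proper_of_size : (forall w, compresses A 3 w -> 3 < size w) -> is_proper A.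
Proof. by move=> len w w3; apply/negP => /len; rewrite w3. Qed.

End MissedStates.

(** * The characterization *)
Theorem proposition19 (A : semiautomaton letter) (s1 s2 x y : state A)
    (ha : has_type A La s1 s2) (hb : has_type A Lb x y) :
  ((compressible A 3 /\ is_proper A) <->
   [\/ [/\ has_type A Lb s2 y, y != s1
         & ~~ ([set run s1 [:: Lb; La]; run s1 [:: Lb; Lb; La];
                    run s1 [:: Lb; Lb; Lb; La]] \subset [set s2; y])
           \/ ~~ (Orb A La (run s1 [:: Lb; La]) \subset [set s2; y])],
       [/\ has_type A Lb x s1, x != s2
         & ~~ ([set run x [:: La; Lb]; run x [:: La; La; Lb];
                    run x [:: La; La; La; Lb]] \subset [set s1; s2])
           \/ ~~ (Orb A Lb (run x [:: La; Lb]) \subset [set s1; s2])]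
     | [/\ has_type A Lb x y /\ x \notin [set s1; s2],
           y != s1,
           run s1 [:: Lb] \in [set s1; s2],
           run x [:: La] \in [set x; y]
         & ~~ (Orb A Lb s1 \subset [set s1; s2])
           \/ ~~ (Orb A La x \subset [set x; y])]])
  /\ (compressible A 3 -> is_proper A ->
      exists2 w, w \in candidate_words & compresses A 3 w).
Proof.
have ab e : e = La \/ e = Lb by case: e; [left | right].
have ba e : e = Lb \/ e = La by case: e; [right | left].
set C := [\/ _, _ | _].
suff [suff_C nec_C] : (C -> is_proper A /\
    exists2 w, w \in candidate_words & compresses A 3 w) /\
  (compressible A 3 -> is_proper A -> C).
  split; last by move=> comp prop; have [] := suff_C (nec_C comp prop).
  split=> [[] // | /suff_C[prop [w _ w3]]]; split=> //; by exists w.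
split.
  case=> [[hb2 y1 escapes] | [hb1 x2 escapes] | [[_ xP] y1 bP aX escapes]].
  - have s1y : s1 != y by rewrite eq_sym.
    split; first by apply: proper_of_size => w /(one_overlap_necessary ba hb2 ha s1y)[].
    have [w wC w3] := one_overlap_sufficient hb2 ha s1y escapes.
    by exists w => //; move: wC; rewrite !inE; do 4![case/orP=> [/eqP-> //|]] => /eqP->.
  - split; first by apply: proper_of_size => w /(one_overlap_necessary ab ha hb1 x2)[].
    have [w wC w3] := one_overlap_sufficient ha hb1 x2 escapes.
    by exists w => //; move: wC; rewrite !inE; do 4![case/orP=> [/eqP-> //|]] => /eqP->.
  have pX : s1 \notin [set x; y].
    by move: xP; rewrite !inE !negb_or ![s1 == _]eq_sym y1 => /andP[->].
  split.
    apply: proper_of_size => w w3.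
    by have [] := no_overlap_necessary ab ha hb xP pX bP aX w3.
  case: escapes => [orbN | orbN].
    by eexists; last exact: no_overlap_orbit ha hb xP pX bP orbN.
  by eexists; last exact: no_overlap_orbit hb ha pX xP aX orbN.
move=> [w w3] prop; rewrite /C.
have [xP | xP] := boolP (x \in [set s1; s2]);
  have [pX | pX] := boolP (s1 \in [set x; y]).
- by have := full_overlap_incompressible ab ha hb w xP pX; rewrite w3.
- have xE : x = s2.
    by case/set2P: xP => // xE; rewrite xE set21 in pX.
  have y1 : y != s1 by apply: contra pX => /eqP ->; rewrite set22.
  rewrite xE in hb; have s1y : s1 != y by rewrite eq_sym.
  apply: Or31; split=> //.
  by have [] := one_overlap_necessary ba hb ha s1y w3.
- have yE : y = s1.
    by case/set2P: pX => // s1E; rewrite s1E set21 in xP.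
  rewrite yE in hb; have x2 : x != s2.
    by apply: contra xP => /eqP ->; rewrite set22.
  apply: Or32; split=> //.
  by have [] := one_overlap_necessary ab ha hb x2 w3.
have bP : step s1 Lb \in [set s1; s2].
  apply: contraT => bP; have := no_overlap_cdc ha hb xP pX bP.
  by rewrite (negbTE (prop _ _)).
have aX : step x La \in [set x; y].
  apply: contraT => aX; have := no_overlap_cdc hb ha pX xP aX.
  by rewrite (negbTE (prop _ _)).
apply: Or33; split=> //.
  by apply: contra pX => /eqP ->; rewrite set22.
by have [] := no_overlap_necessary ab ha hb xP pX bP aX w3.
Qed.
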